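(* Let $q\in\mathbb{N}$, $\lambda>0$, $0<\theta<1$ and $a_1,\dots,a_q>0$, and let $\{\bar G(t)\}_{t\ge0}$ be the multivariate gamma subordinator with these parameters (defined in the context). Then for all $\bar s=(s_1,\dots,s_q)$ with $s_i>0$ for every $i$, and all $t\ge0$, $$\mathbb{E}\big(e^{-\bar{s}\cdot\bar{G}(t)}\big)=\Big(\frac{1-\theta}{\prod_{i=1}^{q}(1+s_ia_i^{-1})-\theta}\Big)^{\lambda t},$$ where $\bar s\cdot\bar G(t)=\sum_{i=1}^q s_iG_i(t)$.
   Context: For $i=1,\dots,q$, $\{Z_i(t)\}_{t\ge0}$ is a gamma Lévy process: $Z_i(0)=0$ and for $t>0$ the variable $Z_i(t)$ has the gamma distribution with shape $\lambda t$ and rate $a_i$, i.e. density $\frac{a_i^{\lambda t}}{\Gamma(\lambda t)}x^{\lambda t-1}e^{-a_ix}$, $x>0$. $\{B^-(\lambda t)\}_{t\ge0}$ is a negative binomial Lévy process with parameter $\theta$: $\Pr\{B^-(\lambda t)=n\}=(1-\theta)^{\lambda t}\binom{n+\lambda t-1}{n}\theta^n$, $n\in\{0,1,2,\dots\}$. The processes $Z_1,\dots,Z_q,B^-$ are mutually independent. The multivariate gamma subordinator is $\bar G(t)=(G_1(t),\dots,G_q(t))$ with $G_i(t)=Z_i\big(t+\lambda^{-1}B^-(\lambda t)\big)$, $t\ge0$; its components are conditionally independent given $\{B^-(\lambda t)\}_{t\ge0}$. *)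

(* Defs.v *)
From mathcomp Require Import all_boot all_order all_algebra.
From mathcomp Require Import all_classical all_reals all_analysis.

Set Implicit Arguments.
Unset Strict Implicit.
Unset Printing Implicit Defensive.
Import Order.TTheory GRing.Theory Num.Theory.
Import numFieldNormedType.Exports.
Local Open Scope classical_set_scope.
Local Open Scope ring_scope.

(* A real-valued process (X_t), t >= 0, is a family X : R -> {RV P >-> R}; only
   the members with nonnegative index are ever constrained. *)

Section Independence.
Context d (T : measurableType d) (R : realType) (P : probability T R).

Definition mutually_independent (I : finType) (F : I -> set (set T)) : Prop :=
  forall (J : {set I}) (A : I -> set T),
    (forall i, i \in J -> F i (A i)) ->
    P (\bigcap_(i in [set` J]) A i) = (\prod_(i in J) P (A i))%E.

Definition rv_events (X : T -> R) : set (set T) :=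
  preimage_set_system setT X measurable.

Definition process_events (X : R -> T -> R) : set (set T) :=
  <<s \bigcup_(t in [set t : R | 0 <= t]) rv_events (X t) >>.

Definition independent_processes (I : finType) (X : I -> R -> {RV P >-> R}) :
    Prop :=
  mutually_independent (fun i => process_events (fun t => X i t)).

End Independence.

Section LevyProcesses.
Context d (T : measurableType d) (R : realType) (P : probability T R).

Definition cadlag (f : R -> R) : Prop :=
  (forall t : R, 0 <= t -> f x @[x --> t^'+] --> f t) /\
  (forall t : R, 0 < t -> cvg (f x @[x --> t^'-])).

(* In levy_indep only u 0 <= ... <= u n matter; a finite grid of times extends
   to a sequence by repeating its last point. *)
Record levy_process (X : R -> {RV P >-> R}) : Prop := LevyProcess {
  levy_0 : {ae P, forall w, X 0 w = 0} ;
  levy_indep : forall (n : nat) (u : nat -> R),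
    0 <= u 0%N -> (forall i, u i <= u i.+1) ->
    mutually_independent P
      (fun i : 'I_n => rv_events (fun w => X (u i.+1) w - X (u i) w)) ;
  levy_stationary : forall (s t : R) (A : set R),
    0 <= s -> 0 <= t -> measurable A ->
    P [set w | A (X (s + t) w - X s w)] = P [set w | A (X t w - X 0 w)] ;
  levy_stoch_cont : forall t e : R, 0 <= t -> 0 < e ->
    P [set w | e < `|X s w - X t w|]
      @[s --> within [set s : R | 0 <= s] (nbhs t)] --> 0%E ;
  levy_cadlag : {ae P, forall w, cadlag (fun t => X t w)}
}.

Definition gamma_function (x : R) : R :=
  \int[lebesgue_measure]_(y in `]0, +oo[) (y `^ (x - 1) * expR (- y)).

(* density on ]0, +oo[ *)
Definition gamma_density (shape rate x : R) : R :=
  rate `^ shape / gamma_function shape * x `^ (shape - 1) * expR (- (rate * x)).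

Definition has_gamma_law (X : {RV P >-> R}) (shape rate : R) : Prop :=
  forall A : set R, measurable A ->
    P (X @^-1` A) =
    (\int[lebesgue_measure]_(x in (A `&` `]0, +oo[)%R)
       (gamma_density shape rate x)%:E)%E.

Definition gamma_levy_process (lambda a : R) (Z : R -> {RV P >-> R}) : Prop :=
  levy_process Z /\ forall t, 0 < t -> has_gamma_law (Z t) (lambda * t) a.

(* x (x - 1) ... (x - n + 1) / n!, the binomial coefficient with real upper
   argument *)
Definition rbinomial (x : R) (n : nat) : R :=
  (\prod_(k < n) (x - k%:R)) / n`!%:R.

(* The index r is the parameter called lambda t in B^-(lambda t). *)
Definition negative_binomial_levy_process (theta : R) (B : R -> {RV P >-> R}) :
    Prop :=
  levy_process B /\
  forall (r : R) (n : nat), 0 <= r ->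
    P (B r @^-1` [set n%:R]) =
    ((1 - theta) `^ r * rbinomial (n%:R + r - 1) n * theta ^+ n)%:E.

Section MultivariateGammaSubordinator.
Variables (q : nat) (lambda : R).
Variables (Z : 'I_q -> R -> {RV P >-> R}) (B : R -> {RV P >-> R}).

Definition mgamma_subordinator (t : R) (i : 'I_q) (w : T) : R :=
  Z i (t + lambda^-1 * B (lambda * t) w) w.

Record mgamma_components (theta : R) (a : 'I_q -> R) : Prop :=
  MgammaComponents {
    mgamma_Z : forall i, gamma_levy_process lambda (a i) (Z i) ;
    mgamma_B : negative_binomial_levy_process theta B ;
    mgamma_indep : independent_processes
      (fun o : option 'I_q => if o is Some i then Z i else B)
  }.

End MultivariateGammaSubordinator.
End LevyProcesses.

(* Main.v *)
(* A measurable function of X integrates against a weight h through the set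
   function A |-> \int_(X^-1 A) h only.  This single transfer principle turns
   independence of events into factorisation of expectations (replacing
   indicators by functions one factor at a time), turns the gamma law into an
   integral against its density, and yields the scaling of gamma integrals.
   Conditionally on B^-(lambda t) = n the Laplace transform is therefore
   \prod_i (1 + s_i / a_i)^-(lambda t + n), and averaging over n is the negative
   binomial series.  That series is summed by noting that the derivative of
   (1 - x)^r \sum_(i <= n) c_i x^i telescopes to a single term. *)
Require Import Defs.
From mathcomp Require Import all_boot all_order all_algebra.
From mathcomp Require Import all_classical all_reals all_analysis.
From mathcomp Require Import measurable_realfun ring lra.

Set Implicit Arguments.
Unset Strict Implicit.
Unset Printing Implicit Defensive.
Import Order.TTheory GRing.Theory Num.Theory.
Import numFieldNormedType.Exports.
Import HBNNSimple.
Local Open Scope classical_set_scope.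
Local Open Scope ring_scope.

(** * Transfer principle for weighted integrals of a function of [X] *)

(** Monotone convergence along the simple approximations of [f]. The limit is not meant to be
    computed: it exhibits that [X], [h] and [mu] enter only through the integrals of [h] over
    preimages under [X]. *)
Lemma integral_comp_weightE d d' (T : measurableType d) (U : measurableType d')
    (R : realType) (mu : {measure set T -> \bar R}) (X : T -> U)
    (h : T -> R) (f : U -> \bar R) (mf : measurable_fun [set: U] f) :
  measurable_fun setT X -> measurable_fun setT h ->
  (forall x, 0 <= h x) -> (forall y, 0 <= f y)%E ->
  (\int[mu]_x (f (X x) * (h x)%:E) =
   limn (fun n => let g := @nnsfun_approx _ U R setT measurableT f mf n in
     \sum_(r \in range g)
       (r%:E * \int[mu]_(x in X @^-1` (g @^-1` [set r])) (h x)%:E)))%E.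
Proof.
move=> mX mh h0 f0; pose g := @nnsfun_approx _ U R setT measurableT f mf.
have mgX n : measurable_fun setT (g n \o X) by exact: measurableT_comp.
have fg x : (f (X x) * (h x)%:E = limn (fun n => (g n (X x))%:E * (h x)%:E))%E.
  apply/esym/cvg_lim => //; apply: cvgeZr => //.
  exact: (@cvg_nnsfun_approx _ U R setT measurableT f mf).
under eq_integral do rewrite fg.
rewrite monotone_convergence//=; last 3 first.
- move=> n; apply: emeasurable_funM; apply/measurable_EFinP => //.
  exact: mgX.
- by move=> n x _; rewrite mule_ge0 ?lee_fin.
- move=> x _ m n mn; rewrite lee_wpmul2r ?lee_fin//.
  exact/lefP/nd_nnsfun_approx.
congr (limn _); apply/funext => n /=; rewrite -/(g n).
have mA r : measurable (X @^-1` (g n @^-1` [set r])).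
  by rewrite -[X in measurable X]setTI; apply: mX.
transitivity (\int[mu]_x \sum_(r \in range (g n))
    ((r * \1_(X @^-1` (g n @^-1` [set r])) x)%:E * (h x)%:E))%E.
  apply: eq_integral => x _; rewrite -ge0_mule_fsuml; last first.
    by move=> r; exact: (nnfun_muleindic_ge0 (g n)).
  by rewrite fsumEFin // [in LHS]fimfunE.
rewrite ge0_integral_fsum//; last 2 first.
- move=> r; apply: emeasurable_funM; apply/measurable_EFinP => //.
  by apply: measurable_funM => //; exact: measurable_indic.
- move=> r x _; rewrite mule_ge0 ?lee_fin//.
  exact: (nnfun_muleindic_ge0 (g n)).
apply: eq_fsbigr => r; rewrite inE => -[y _ <-]; set r' := g n y.
under eq_integral do rewrite EFinM -muleA.
rewrite ge0_integralZl ?lee_fin//.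
- congr (_ * _)%E; rewrite [RHS]integral_mkcond; apply: eq_integral => x _.
  by rewrite epatch_indic muleC.
- apply: emeasurable_funM; apply/measurable_EFinP => //.
- by move=> x _; rewrite mule_ge0 ?lee_fin.
Qed.

(** Both sides are the same limit, because the level sets of the simple approximations are
    measurable. The two source spaces may differ, which allows passing from [P] to Lebesgue
    measure. *)
Lemma eq_integral_comp_weight d1 d2 d (T1 : measurableType d1)
    (T2 : measurableType d2) (U : measurableType d) (R : realType)
    (mu1 : {measure set T1 -> \bar R}) (mu2 : {measure set T2 -> \bar R})
    (X1 : T1 -> U) (X2 : T2 -> U) (h1 : T1 -> R) (h2 : T2 -> R) :
  measurable_fun setT X1 -> measurable_fun setT h1 -> (forall x, 0 <= h1 x) ->
  measurable_fun setT X2 -> measurable_fun setT h2 -> (forall x, 0 <= h2 x) ->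
  (forall A, measurable A -> \int[mu1]_(x in X1 @^-1` A) (h1 x)%:E =
                             \int[mu2]_(x in X2 @^-1` A) (h2 x)%:E)%E ->
  forall f : U -> \bar R, measurable_fun setT f -> (forall y, 0 <= f y)%E ->
  (\int[mu1]_x (f (X1 x) * (h1 x)%:E) = \int[mu2]_x (f (X2 x) * (h2 x)%:E))%E.
Proof.
move=> mX1 mh1 h10 mX2 mh2 h20 h12 f mf f0.
rewrite !(integral_comp_weightE _ mf)//; congr (limn _).
apply/funext => n /=; apply: eq_fsbigr => r _; congr (_ * _)%E; apply: h12.
exact: measurable_sfunP.
Qed.

(** * Independence and products of expectations *)

(** Induction on the set of factors allowed to be arbitrary. If all are indicators, this is
    independence of events for the full index set. To free factor [i], the others are frozen into a
    weight, and the transfer principle extends the identity from indicators to [phi i]. *)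
Lemma indep_expectation_prod d (T : measurableType d) (R : realType)
    (P : probability T R) (I : finType) (X : I -> {RV P >-> R})
    (indepX : mutually_independent P (fun i => rv_events (X i)))
    (phi : I -> R -> R) :
  (forall i, measurable_fun setT (phi i)) -> (forall i x, 0 <= phi i x) ->
  (forall i, \int[P]_w (phi i (X i w))%:E \is a fin_num)%E ->
  (\int[P]_w (\prod_i phi i (X i w))%:E =
   \prod_i \int[P]_w (phi i (X i w))%:E)%E.
Proof.
suff main (s : seq I) : forall phi : I -> R -> R,
    (forall i, i \notin s -> exists2 A, measurable A & phi i = \1_A) ->
    (forall i, measurable_fun setT (phi i)) -> (forall i x, 0 <= phi i x) ->
    (forall i, \int[P]_w (phi i (X i w))%:E \is a fin_num)%E ->
    (\int[P]_w (\prod_i phi i (X i w))%:E =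
     \prod_i \int[P]_w (phi i (X i w))%:E)%E.
  by move=> *; apply: (main (enum I)) => // i; rewrite mem_enum.
have indicX (A : set R) i w : (\1_A (X i w) = \1_(X i @^-1` A) w :> R).
  by rewrite !indicE; congr (_%:R); apply/asboolP/asboolP.
have mX i (A : set R) : measurable A -> measurable (X i @^-1` A).
  by move=> mA; rewrite -[_ @^-1` _]setTI; exact: measurable_funP.
(* s lists the factors that need not be indicators *)
elim: s => [|i s IH] {}phi phiI mphi phi0 phifin.
  have /choice[A AP] i : exists A, measurable A /\ phi i = \1_A.
    by have [//|A mA ->] := phiI i; exists A.
  have -> : (\int[P]_w (\prod_i phi i (X i w))%:E =
      P (\bigcap_(i in [set` [set: I]%SET]) (X i @^-1` A i)))%E.
    rewrite -(setIT (\bigcap_(_ in _) _)) -integral_indic//; last first.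
      by apply: fin_bigcap_measurable => // i _; apply: mX; case: (AP i).
    apply: eq_integral => w _; congr EFin; rewrite indicE.
    have [wA|/asboolPn/existsNP[i /not_implyP[_ wA]]] := boolP (w \in _).
      by rewrite big1// => i _; have [_ ->] := AP i; rewrite indicE mem_set//;
        move/set_mem : wA; apply; rewrite /= inE.
    rewrite (bigD1 i)//=; have [_ ->] := AP i.
    by rewrite indicE memNset// mul0r.
  rewrite indepX => [|i _]; last first.
    by exists (A i); [case: (AP i)|rewrite setTI].
  under eq_bigl do rewrite inE.
  apply: eq_bigr => i _; have [mA ->] := AP i.
  under eq_integral do rewrite indicX.
  by rewrite integral_indic ?setIT//; exact: mX.
have [is_s|iNs] := boolP (i \in s).
  by apply: IH => // j js; apply: phiI; rewrite inE negb_or js andbT;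
     apply: contraNneq js => ->.
set h := fun w => \prod_(j | j != i) phi j (X j w).
set c := (\prod_(j | j != i) fine (\int[P]_w (phi j (X j w))%:E))%R.
have h0 w : 0 <= h w by exact: prodr_ge0.
have mphiX j : measurable_fun setT (fun w => phi j (X j w)).
  by apply: measurableT_comp.
have mh : measurable_fun setT h.
  rewrite /h; under eq_fun do rewrite big_mkcond.
  apply: measurable_prod => j _; case: (j != i) => // _.
have c0 : 0 <= c.
  apply: prodr_ge0 => j _; apply/fine_ge0/integral_ge0 => w _.
  by rewrite lee_fin.
have cE : (\prod_(j | j != i) \int[P]_w (phi j (X j w))%:E = c%:E)%E.
  by rewrite -prodEFin; apply: eq_bigr => j _; rewrite fineK.
rewrite [RHS](bigD1 i)//= cE.
(* The constant [c] is kept inside the integral as a weight, so that both sides have the shape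
   required by the transfer principle. Finiteness of the expectations makes [c] a real number. *)
transitivity (\int[P]_w ((phi i (X i w))%:E * c%:E))%E; last first.
  rewrite ge0_integralZr ?lee_fin//; first exact/measurable_EFinP.
  by move=> w _; rewrite lee_fin.
under eq_integral do rewrite (bigD1 i)//= EFinM.
apply: (@eq_integral_comp_weight _ _ _ _ _ _ _ P P (X i) (X i) h (cst c)
  _ _ _ _ _ _ _ (EFin \o phi i)) => //.
- move=> A mA.
  (* With factor [i] replaced by an indicator, only the indices in [s] remain arbitrary and the
     induction hypothesis applies. *)
  pose psi j := if j == i then \1_A else phi j.
  have : (\int[P]_w (\prod_j psi j (X j w))%:E =
          \prod_j \int[P]_w (psi j (X j w))%:E)%E.
    apply: IH.
    + move=> j js; rewrite /psi; case: eqVneq => [_|ji]; first by exists A.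
      by apply: phiI; rewrite inE negb_or ji.
    + by move=> j; rewrite /psi; case: ifP.
    + by move=> j x; rewrite /psi; case: ifP.
    + move=> j; rewrite /psi; case: eqVneq => [->|ji]//.
      under eq_integral do rewrite indicX.
      rewrite integral_indic ?setIT//; last exact: mX.
      exact: fin_num_measure (mX _ _ _).
  rewrite [RHS](bigD1 i)//= /psi eqxx.
  under [X in (_ * X)%E]eq_bigr => j /negbTE ji do rewrite ji.
  rewrite cE.
  have <- : (\int[P]_w ((\1_A (X i w))%:E * c%:E) =
             \int[P]_w (\1_A (X i w))%:E * c%:E)%E.
    rewrite ge0_integralZr ?lee_fin//.
    by apply/measurable_EFinP; apply: measurableT_comp.
  move=> e; rewrite [LHS]integral_mkcond [RHS]integral_mkcond.
  transitivity (\int[P]_w (\prod_j psi j (X j w))%:E)%E.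
    apply: eq_integral => w _; rewrite (bigD1 i)//= /psi eqxx.
    under [X in (_ * X)%R]eq_bigr => j /negbTE ji do rewrite ji.
    by rewrite epatch_indic indicX mulrC EFinM.
  rewrite e; apply: eq_integral => w _.
  by rewrite epatch_indic indicX muleC.
- by apply/measurable_EFinP.
- by move=> y; rewrite lee_fin.
Qed.

(** * Gamma integrals and the Laplace transform of the gamma law *)

(** Uniqueness of Lebesgue measure: [b] times its pushforward under multiplication by [b] gives
    half-open intervals their length. *)
Lemma lebesgue_measure_mul (R : realType) (b : R) (A : set R) : 0 < b ->
  measurable A ->
  (b%:E * lebesgue_measure [set x : R | A (b * x)%R] = lebesgue_measure A)%E.
Proof.
move=> b0 mA.
pose g : measurableTypeR R -> measurableTypeR R := fun x : R => (b * x : R).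
have mg : measurable_fun setT g by exact: mulrl_measurable.
apply/esym/(@lebesgue_measure_unique R
  (mscale (NngNum (ltW b0)) (pushforward (@lebesgue_measure R) g))) => //.
move=> _ [[x y] _ <-].
rewrite /= /mscale /= /pushforward /=.
have -> : g @^-1` `]x, y] = `]b^-1 * x, b^-1 * y]%classic.
  apply/seteqP; split=> z /=; rewrite !in_itv /= /g.
    by rewrite ler_pdivlMl// ltr_pdivrMl.
  by rewrite ler_pdivlMl// ltr_pdivrMl.
rewrite !lebesgue_measure_itv/= !lte_fin ltr_pM2l ?invr_gt0//.
case: ifP => _; last by rewrite mule0.
by rewrite -!EFinD -EFinM -mulrBr mulrA divff ?mul1r ?gt_eqF.
Qed.

Lemma measurable_expRNM (R : realType) (c : R) :
  measurable_fun setT (fun x : R => expR (- (c * x))).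
Proof.
by apply: measurableT_comp => //; exact: measurableT_comp.
Qed.

Lemma measurable_gamma_kernel (R : realType) (k c : R) :
  measurable_fun setT (fun x : R => x `^ (k - 1) * expR (- (c * x))).
Proof.
apply: measurable_funM; first exact: measurable_powR.
exact: measurable_expRNM.
Qed.

(** Change of variable [y = b * x], as an instance of the transfer principle with weight [b] on one
    side and weight [1] on the other. The identity lives in the extended reals, so infinite
    integrals are covered. *)
Lemma gamma_kernel_scale (R : realType) (k b : R) : 0 < b ->
  ((b `^ k)%:E *
   \int[lebesgue_measure]_(x in `]0%R, +oo[)
     (x `^ (k - 1) * expR (- (b * x)))%:E =
   \int[lebesgue_measure]_(x in `]0%R, +oo[) (x `^ (k - 1) * expR (- x))%:E)%E.
Proof.
move=> b0.
pose f (x : R) :=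
  ((EFin \o (fun x => x `^ (k - 1) * expR (- x))) \_ `]0%R, +oo[) x.
have mf : measurable_fun setT f.
  apply/(measurable_restrictT _ _).1 => //.
  apply/measurable_EFinP; apply: measurable_funTS.
  under eq_fun do rewrite -[X in expR (- X)]mul1r.
  exact: measurable_gamma_kernel.
have f0 y : (0 <= f y)%E.
  by apply: erestrict_ge0 => x _; rewrite lee_fin mulr_ge0 ?powR_ge0 ?expR_ge0.

have scale A : measurable A ->
    (\int[lebesgue_measure]_(x in (fun x : R => b * x)%R @^-1` A) (cst b x)%:E =
    \int[lebesgue_measure]_(x in id @^-1` A) (cst 1%R x)%:E)%E.
  move=> mA; rewrite preimage_id (integral_cst lebesgue_measure mA 1%:E) mul1e.
  rewrite (integral_cst lebesgue_measure _ b%:E) ?lebesgue_measure_mul//.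
  by rewrite -[X in measurable X]setTI; exact: (mulrl_measurable b).
rewrite [in RHS]integral_mkcond.
transitivity (\int[lebesgue_measure]_x (f (b * x)%R * b%:E))%E; last first.
  have /= -> := @eq_integral_comp_weight _ _ _ _ _ _ R lebesgue_measure
    lebesgue_measure ( *%R b) id (cst b) (cst 1) (mulrl_measurable b)
    (measurable_cst b) (fun _ => ltW b0) (@measurable_id _ _ _)
    (measurable_cst _) (fun _ => ler01) scale f mf f0.
  by apply: eq_integral => x _; rewrite mule1.
rewrite -ge0_integralZl ?lee_fin ?powR_ge0//; last 2 first.
- by apply/measurable_EFinP/measurable_funTS; exact: measurable_gamma_kernel.
- by move=> x _; rewrite lee_fin mulr_ge0 ?powR_ge0 ?expR_ge0.
rewrite integral_mkcond; apply: eq_integral => x _.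
rewrite /f !patchE /= !mem_setE !in_itv/= !andbT pmulr_rgt0//.
case: ifPn => [x0|]; last by rewrite mul0e.
rewrite -!EFinM; congr EFin; rewrite powRM ?ltW//.
have -> : b `^ k = b `^ (k - 1) * b.
  by rewrite -{1}(subrK 1 k) (@powRD _ _ (k - 1)) ?powRr1 ?ltW ?(gt_eqF b0)
    ?implybT.
by ring.
Qed.

(* The normalising constant enters only through the total mass 1 of the law, so
   neither finiteness nor positivity of gamma_function k has to be proved. *)
Lemma gamma_law_laplace d (T : measurableType d) (R : realType)
    (P : probability T R) (X : {RV P >-> R}) (k a s : R) :
  0 < a -> 0 < s -> has_gamma_law X k a ->
  (\int[P]_w (expR (- (s * X w)))%:E = ((1 + s / a) `^ (- k))%:E)%E.
Proof.
move=> a0 s0 XP.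
set C := a `^ k / gamma_function k.
have C0 : 0 <= C.
  rewrite divr_ge0 ?powR_ge0// Rintegral_ge0// => x _.
  by rewrite mulr_ge0 ?powR_ge0 ?expR_ge0.
pose I b := (\int[lebesgue_measure]_(x in `]0%R, +oo[)
  (x `^ (k - 1) * expR (- (b * x)))%:E)%E.
have densE x : gamma_density k a x = C * (x `^ (k - 1) * expR (- (a * x))).
  by rewrite /gamma_density mulrA.
have mdens : measurable_fun setT (gamma_density k a).
  rewrite (_ : gamma_density k a =
    fun x => C * (x `^ (k - 1) * expR (- (a * x)))); last exact/funext.
  by apply: measurable_funM => //; exact: measurable_gamma_kernel.
have dens0 x : 0 <= gamma_density k a x.
  rewrite densE mulr_ge0// mulr_ge0 ?powR_ge0 ?expR_ge0//.
have IC b : (\int[lebesgue_measure]_(x in `]0%R, +oo[)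
    (C * (x `^ (k - 1) * expR (- (b * x))))%:E = C%:E * I b)%E.
  under eq_integral do rewrite EFinM.
  rewrite ge0_integralZl ?lee_fin//.
  - by apply/measurable_EFinP/measurable_funTS; exact: measurable_gamma_kernel.
  - by move=> x _; rewrite lee_fin mulr_ge0 ?powR_ge0 ?expR_ge0.
have Ia : (C%:E * I a = 1)%E.
  rewrite -IC -(probability_setT P) -(preimage_setT (X : T -> R)) XP// setTI.
  by apply: eq_integral => x _; rewrite densE.
have -> : (\int[P]_w (expR (- (s * X w)))%:E = C%:E * I (a + s)%R)%E.
  rewrite -IC.
  have mind : measurable_fun setT (gamma_density k a \_ `]0, +oo[).
    exact/(measurable_restrictT _ _).1/measurable_funTS.
  have meX : measurable_fun setT (fun x => (expR (- (s * x)))%:E).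
    by apply/measurable_EFinP; exact: measurable_expRNM.
  transitivity (\int[P]_w ((expR (- (s * X w)))%:E * 1))%E.
    by apply: eq_integral => w _; rewrite mule1.
  (* Weight [1] under [P] is exchanged for the density under Lebesgue measure; the gamma law is the
     required identity on preimages. *)
  have /= -> := @eq_integral_comp_weight _ _ _ _ _ _ R P lebesgue_measure
   X id (cst 1) (gamma_density k a \_ `]0, +oo[) _ (measurable_cst _)
   (fun _ => ler01) (@measurable_id _ _ _) mind _ _
   (fun x => (expR (- (s * x)))%:E) meX => //.
  - rewrite [RHS]integral_mkcond; apply: eq_integral => x _.
    rewrite !patchE; case: ifPn => _; last by rewrite mule0.
    rewrite densE -EFinM; congr EFin.
    by rewrite mulrDl opprD expRD; ring.
  - by move=> x; apply: restrict_ge0 => y _.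
  - move=> A mA; rewrite preimage_id (integral_cst P _ 1%:E) ?mul1e; last first.
      by rewrite -[X in measurable X]setTI; exact: measurable_funP.
    by apply: (etrans (XP A mA)); rewrite integral_mkcondr restrict_EFin.
have as0 : 0 < a + s by rewrite addr_gt0.
(* Both sides equal the kernel integral at rate [1]; this fixes [I (a + s)] in terms of [I a]. *)
have : (((a + s) `^ k)%:E * I (a + s)%R = (a `^ k)%:E * I a)%E.
  by rewrite !gamma_kernel_scale.
(* If [I a] were infinite, [C * I a] would be [0] or [+oo] according to whether [C] vanishes,
   contradicting [Ia]. *)
have : I a \is a fin_num.
  rewrite ge0_fin_numE; last first.
    apply: integral_ge0 => x _.
    by rewrite lee_fin mulr_ge0 ?powR_ge0 ?expR_ge0.
  move: Ia; case: (I a) => [r|//|//]; rewrite ?ltry//.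
  rewrite mulry; move: C0; rewrite le_eqVlt => /predU1P[<-|C0].
    by rewrite sgr0 mul0e => -[/esym/eqP]; rewrite oner_eq0.
  by rewrite gtr0_sg// mul1e.
move=> /fineK IaE; rewrite -IaE in Ia * => IaI.
have ask0 : (a + s) `^ k != 0 by rewrite gt_eqF ?powR_gt0.
have -> : I (a + s)%R = ((a + s) `^ (- k) * (a `^ k * fine (I a)))%:E.
  by rewrite !EFinM -IaI muleA -EFinM powRN mulVf// mul1e.
move: Ia; rewrite -!EFinM => -[CI]; congr EFin.
transitivity ((a + s) `^ (- k) * a `^ k * (C * fine (I a))); first by ring.
rewrite CI mulr1.
have -> : 1 + s / a = (a + s) * a^-1 by rewrite mulrDl divff ?gt_eqF.
rewrite powRM ?invr_ge0 ?ltW//; congr (_ * _).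
by rewrite -powR_inv1 ?ltW// -powRrM mulN1r opprK.
Qed.

(** * The negative binomial series *)

(** This is [r (r + 1) ... (r + n - 1) / n!], given by its ratio of consecutive terms, the form used
    for both telescoping and the ratio test. *)
Fixpoint rising_coef (R : realType) (r : R) (n : nat) : R :=
  if n is m.+1 then rising_coef r m * ((r + m%:R) / m.+1%:R) else 1.

Lemma rbinomial_rising (R : realType) (r : R) n :
  rbinomial (n%:R + r - 1) n = rising_coef r n.
Proof.
rewrite /rbinomial (reindex_inj rev_ord_inj) /=.
transitivity ((\prod_(k < n) (r + k%:R)) / n`!%:R).
  congr (_ / _); apply: eq_bigr => k _.
  rewrite natrB// -addn1 natrD; ring.
elim: n => [|n IH]; first by rewrite big_ord0 fact0 divr1.
rewrite big_ord_recr /= -IH factS natrM invfM; ring.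
Qed.

Lemma rising_coef_ge0 (R : realType) (r : R) n : 0 <= r -> 0 <= rising_coef r n.
Proof.
move=> r0; elim: n => //= n IH.
by rewrite mulr_ge0// divr_ge0// addr_ge0.
Qed.

Lemma rising_coefS (R : realType) (r : R) n :
  n.+1%:R * rising_coef r n.+1 = (r + n%:R) * rising_coef r n.
Proof. by rewrite /= mulrCA [n.+1%:R * _]mulrC divfK ?pnatr_eq0// mulrC. Qed.

Section binomial_series.
Context (R : realType) (r : R) (r0 : 0 <= r).
Let c := rising_coef r.
Let S n (x : R) := \sum_(0 <= i < n) c i * x ^+ i.

(** In the induction, the new term [c n.+1 * x ^+ n.+1] contributes [(n + 1) c_(n+1) x^n - (r + n +
    1) c_(n+1) x^(n+1)] times the power of [1 - x]. By [rising_coefS] the first part cancels the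
    previous remainder. *)
Let is_derive_partial n (x : R) : x < 1 ->
  is_derive x 1 (fun x => (1 - x) `^ r * S n.+1 x)
    (- ((1 - x) `^ (r - 1) * ((r + n%:R) * c n) * x ^+ n)).
Proof.
move=> x1.
have x1' : 0 < 1 - x by rewrite subr_gt0.
have dp : is_derive x 1 (fun x => (1 - x) `^ r) (- (r * (1 - x) `^ (r - 1))).
  have d1 : is_derive x 1 (fun x : R => 1 - x) (-1).
    by apply: (is_derive_eq (is_deriveB _ _)); rewrite sub0r.
  have dd := @is_derive1_comp R (fun y => y `^ r) (fun x => 1 - x) x _ _
    (is_derive1_powR r x1') d1.
  by apply: (is_derive_eq dd); rewrite mulrN1.
elim: n => [|n IH].
  rewrite (_ : (fun _ => _) = fun x => (1 - x) `^ r); last first.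
    by apply/funext => y; rewrite /S big_nat1 expr0 !mulr1.
  by apply: (is_derive_eq dp); rewrite addr0 expr0 /c /=; ring.
rewrite (_ : (fun _ => _) = (fun x => (1 - x) `^ r * S n.+1 x) +
    (fun x => (1 - x) `^ r) * (cst (c n.+1) * (fun x => x ^+ n.+1)));
  last first.
  by apply/funext => y; rewrite /S big_nat_recr//= mulrDr.
have dX : is_derive x 1 (fun x : R => x ^+ n.+1) (n.+1%:R * x ^+ n).
  rewrite (_ : (fun _ => _) = id ^+ n.+1); last by rewrite exprfctE.
  apply: (is_derive_eq (is_deriveX n.+1 (is_derive_id x 1))).
  by rewrite /= -[_ *: _]/(_ * _) mulr1.
have dc := is_deriveM dp (is_deriveM (is_derive_cst (c n.+1) x 1) dX).
apply: (is_derive_eq (is_deriveD IH dc)).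
rewrite -!/(_ * _) /=.
have -> : (1 - x) `^ r = (1 - x) * (1 - x) `^ (r - 1).
  by rewrite -{1}(subrK 1 r) (@powRD _ _ (r - 1)) ?powRr1 1?mulrC ?ltW
    ?(gt_eqF x1') ?implybT.
rewrite -rising_coefS -/c.
rewrite -!/(_ * _).
transitivity (- ((1 - x) `^ (r - 1) * (n.+1%:R * c n.+1) * x ^+ n) +
  ((1 - x) * (1 - x) `^ (r - 1) *
     (c n.+1 * (n.+1%:R * x ^+ n) + x ^+ n.+1 * 0) +
   c n.+1 * x ^+ n.+1 * - (r * (1 - x) `^ (r - 1)))); first by [].
by rewrite exprS; ring.
Qed.

Let u n (x : R) := (r + n%:R) * c n * x ^+ n.

Let u_ge0 n x : 0 <= x -> 0 <= u n x.
Proof.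
by move=> x0; rewrite !mulr_ge0 ?exprn_ge0 ?rising_coef_ge0 ?addr_ge0.
Qed.

(** Ratio test: successive terms have ratio [x (r + n + 1) / (n + 1)], eventually at most the
    midpoint [y] of [x] and [1], whence geometric domination. *)
Let cvg_u0 (x : R) : 0 <= x < 1 -> u n x @[n --> \oo] --> (0 : R).
Proof.
move=> /andP[x0 x1]; pose y := (1 + x) / 2.
have xy : x < y by rewrite /y; lra.
have y0 : 0 <= y by rewrite /y; lra.
have y1 : y < 1 by rewrite /y; lra.
(* From [N] on, [r x <= (y - x) (n + 1)], which is [x (r + n + 1) <= y (n + 1)]. *)
pose N := Num.bound (r * x / (y - x)).
have uS n : (N <= n)%N -> u n.+1 x <= y * u n x.
  move=> Nn.
  have le_n : r * x <= (y - x) * n.+1%:R.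
    rewrite [leRHS]mulrC -ler_pdivrMr ?subr_gt0//.
    apply: (@le_trans _ _ N%:R); last by rewrite ler_nat (leq_trans Nn).
    by rewrite ltW// archi_boundP// divr_ge0 ?mulr_ge0// subr_ge0 ltW.
  rewrite /u -(rising_coefS r n) -/c exprS.
  have -> : (r + n.+1%:R) * c n.+1 * (x * x ^+ n) =
      (r * x + n.+1%:R * x) * (c n.+1 * x ^+ n) by ring.
  have -> : y * (n.+1%:R * c n.+1 * x ^+ n) =
      (y * n.+1%:R) * (c n.+1 * x ^+ n) by ring.
  apply: ler_wpM2r; first by rewrite mulr_ge0 ?exprn_ge0 ?rising_coef_ge0.
  by move: le_n; lra.
have uN k : u (k + N)%N x <= y ^+ k * u N x.
  elim: k => [|k IH]; first by rewrite expr0 mul1r.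
  rewrite addSn (le_trans (uS _ _)) ?leq_addl//.
  by rewrite exprS -mulrA ler_wpM2l.
rewrite -(cvg_shiftn N).
apply: (@squeeze_cvgr _ _ _ _ (cst 0) (fun k => y ^+ k * u N x)).
- by near=> k; rewrite u_ge0//= uN.
- exact: cvg_cst.
- rewrite -[X in _ --> X](mul0r (u N x)); apply: cvgMl.
  by apply: cvg_expr; rewrite ger0_norm.
Unshelve. all: by end_near. Qed.

(** The mean value theorem on [[0, x]] squeezes [(1 - x)^r S_(n+1)(x)] between [1] minus a multiple
    of [u n x] and [1], its value at [0]. *)
Lemma cvg_rising_series (x : R) : 0 <= x < 1 ->
  \sum_(0 <= i < n) rising_coef r i * x ^+ i @[n --> \oo] --> (1 - x) `^ (- r).
Proof.
move=> x01; have /andP[x0 x1] := x01.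
rewrite -/(S _ x) -(cvg_shiftS (fun n => S n x)).
have x1' : 0 < 1 - x by rewrite subr_gt0.
suff g1 : (1 - x) `^ r * S n.+1 x @[n --> \oo] --> (1 : R).
  rewrite -[_ `^ (- r)]mulr1.
  have -> : (fun n => S n.+1 x) =
      fun n => (1 - x) `^ (- r) * ((1 - x) `^ r * S n.+1 x).
    by apply/funext => n; rewrite powRN mulKf// gt_eqF ?powR_gt0.
  by apply: cvgMr.
have bound n : 1 - (1 - x)^-1 * u n x <= (1 - x) `^ r * S n.+1 x <= 1.
  pose g (z : R) := (1 - z) `^ r * S n.+1 z.
  have g0 : g 0 = 1.
    rewrite /g /S big_nat_recl//= big1 => [|i _]; last by rewrite expr0n mulr0.
    by rewrite subr0 powR1 expr0 /c /= addr0 !mulr1.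
  pose dg z : R := - ((1 - z) `^ (r - 1) * ((r + n%:R) * c n) * z ^+ n).
  have g_dg (z : R) : z < 1 -> is_derive z 1 g (dg z).
    exact: is_derive_partial.
  have [||xi] := @MVT_segment _ g dg 0 x x0.
  - by move=> z /itvP zx; apply: g_dg; rewrite (le_lt_trans _ x1)// zx.
  - apply: derivable_within_continuous => z /itvP zx.
    by case: (g_dg z _) => //; rewrite (le_lt_trans _ x1)// zx.
  rewrite in_itv/= => /andP[xi0 xix]; rewrite g0 subr0 -/(g x) => gx.
  have xi1' : 0 < 1 - xi by lra.
  have gE : g x = 1 - (1 - xi) `^ (r - 1) * u n xi * x.
    by rewrite -(subrK 1 (g x)) gx /dg /u; ring.
  have t0 : 0 <= (1 - xi) `^ (r - 1) * u n xi.
    by rewrite mulr_ge0 ?powR_ge0 ?u_ge0.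
  rewrite gE; apply/andP; split; last by rewrite gerBl mulr_ge0.
  rewrite lerD2l lerN2.
  rewrite (@le_trans _ _ ((1 - xi) `^ (r - 1) * u n xi))//.
    by apply: ler_piMr => //; exact: ltW.
  (* Uniformly in [xi <= x]: [(1 - xi)^(r - 1) <= 1 / (1 - xi) <= 1 / (1 - x)] since [r >= 0], and
     [u n] is nondecreasing. *)
  apply: ler_pM => //; rewrite ?powR_ge0 ?u_ge0//.
    have -> : (1 - xi) `^ (r - 1) = (1 - xi) `^ r * (1 - xi)^-1.
      by rewrite powRD ?powR_inv1 ?(ltW xi1') ?(gt_eqF xi1') ?implybT.
    rewrite (@le_trans _ _ (1 - xi)^-1)//.
      apply: ler_piMl; first by rewrite invr_ge0 ltW.
      rewrite -[leRHS](powRr0 (1 - xi)) ger_powR// xi1'; lra.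
    rewrite lef_pV2 ?posrE//; lra.
  rewrite /u ler_wpM2l ?mulr_ge0 ?rising_coef_ge0 ?addr_ge0//.
  by rewrite lerXn2r ?nnegrE.
apply: (@squeeze_cvgr _ _ _ _ (fun n => 1 - (1 - x)^-1 * u n x) (cst 1)).
- by near=> n; exact: bound.
- rewrite -[X in _ --> X]subr0; apply: cvgB; first exact: cvg_cst.
  by rewrite -(mulr0 (1 - x)^-1); apply: cvgMr; exact: cvg_u0.
- exact: cvg_cst.
Unshelve. all: by end_near. Qed.

End binomial_series.

(** * Integrals of functions known only off a null set *)

(** Immediate from the integral as a supremum over simple functions below the integrand, hence
    usable for integrands not known to be measurable. *)
Lemma le_integralT_ge0 d (T : measurableType d) (R : realType)
    (mu : {measure set T -> \bar R}) (f g : T -> \bar R) :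
  (forall x, 0 <= f x)%E -> (forall x, f x <= g x)%E ->
  (\int[mu]_x f x <= \int[mu]_x g x)%E.
Proof.
move=> f0 fg; rewrite !ge0_integralTE//; last first.
  by move=> x; rewrite (le_trans (f0 x)).
apply: ereal_sup_le => _ [h hf <-]; exists h => // x.
by rewrite (le_trans (hf x)).
Qed.

(* f itself need not be measurable: the composition Z_i(t + B/lambda) is only
   known to agree almost surely with a measurable function. *)
Lemma ge0_eq_integral_off_null d (T : measurableType d) (R : realType)
    (mu : {measure set T -> \bar R}) (N : set T) (f g : T -> \bar R) :
  measurable N -> mu N = 0%E -> measurable_fun setT g ->
  (forall x, 0 <= f x)%E -> (forall x, 0 <= g x)%E ->
  (forall x, ~ N x -> f x = g x) -> (\int[mu]_x f x = \int[mu]_x g x)%E.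
Proof.
move=> mN N0 mg f0 g0 fg; apply/eqP; rewrite eq_le; apply/andP; split.
  (* Upper bound: [f] lies below [g] plus the function equal to [+oo] on [N] and [0] elsewhere,
     whose integral is zero. *)
  have mNy : measurable_fun setT ((cst +oo%E : T -> \bar R) \_ N).
    exact/(measurable_restrictT _ _).1.
  have Ny0 x : (0 <= ((cst +oo%E : T -> \bar R) \_ N) x)%E.
    by apply: erestrict_ge0 => y _; exact: le0y.
  rewrite -[leRHS]adde0.
  rewrite -[X in (_ <= _ + X)%E](_ : \int[mu]_x (cst +oo%E \_ N) x = _)%E;
    last first.
    by rewrite -integral_mkcond integral_cst// N0 mule0.
  rewrite -ge0_integralD//; apply: le_integralT_ge0 => // x.
  rewrite patchE; case: ifPn => [_|/negP xN].
    by rewrite addey ?leey// gt_eqF// (lt_le_trans _ (g0 x)).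
  by rewrite adde0 fg// => Nx; apply: xN; rewrite inE.
(* Lower bound: [g] cut off to the complement of [N] keeps its integral and lies below [f]. *)
rewrite (ge0_negligible_integral mN measurableT)// setTD integral_mkcond.
apply: le_integralT_ge0 => x; first by apply: erestrict_ge0 => ? _.
by rewrite patchE; case: ifPn => //; rewrite inE => /fg ->.
Qed.

(** * Ingredients for conditioning on the negative binomial process *)

(** The gamma law is prescribed at positive times only; at time [0] the process vanishes almost
    surely and both sides are [1]. *)
Lemma gamma_process_laplace d (T : measurableType d) (R : realType)
    (P : probability T R) (lambda a : R) (Z : R -> {RV P >-> R}) (s u : R) :
  0 < lambda -> 0 < a -> 0 < s -> 0 <= u -> gamma_levy_process lambda a Z ->
  (\int[P]_w (expR (- (s * Z u w)))%:E =
   ((1 + s / a) `^ (- (lambda * u)))%:E)%E.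
Proof.
move=> l0 a0 s0; rewrite le_eqVlt => /predU1P[<-|u0] [ZL Zlaw]; last first.
  by apply: gamma_law_laplace => //; exact: Zlaw.
rewrite mulr0 oppr0 powRr0 (ae_eq_integral (cst 1%E))//.
- by rewrite integral_cst// mul1e; exact: probability_setT.
- apply/measurable_EFinP; apply: measurableT_comp => //.
  apply: measurableT_comp => //.
  by apply: measurable_funM.
- case: ZL => + _ _ _ _; apply: filterS => w /= -> _.
  by rewrite mulr0 oppr0 expR0.
Qed.

Lemma big_option (A : Type) (idx : A) (op : Monoid.com_law idx) (I : finType)
    (F : option I -> A) :
  \big[op/idx]_o F o = op (F None) (\big[op/idx]_i F (Some i)).
Proof.
rewrite (bigD1 None)//=; congr (op _ _).
rewrite (reindex_omap Some id) => [|[i|]]//.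
by apply: eq_bigl => i; rewrite eqxx.
Qed.

Lemma prod_powR (R : realType) (I : finType) (F : I -> R) (p : R) :
  (forall i, 0 <= F i) -> \prod_i (F i `^ p) = (\prod_i F i) `^ p.
Proof.
move=> F0.
suff [] : \prod_i (F i `^ p) = (\prod_i F i) `^ p /\ 0 <= \prod_i F i by [].
elim/big_rec2: _ => [|i x y _ [-> x0]]; first by rewrite powR1.
by rewrite powRM// mulr_ge0.
Qed.

Lemma nneseries_rising (R : realType) (r K x : R) : 0 <= r -> 0 <= x < 1 ->
  (\sum_(0 <= n <oo) (K * (rising_coef r n * x ^+ n))%:E =
   (K * (1 - x) `^ (- r))%:E)%E.
Proof.
move=> r0 x01; apply: cvg_lim => //.
under eq_fun do rewrite sumEFin -mulr_sumr.
by apply: cvg_EFin; [exact: nearW|apply: cvgMr; exact: cvg_rising_series].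
Qed.

(** The binomial series at [theta / p], which is below [1]. The case [p = 1] says that the weights
    have total mass [1]. *)
Lemma negative_binomial_pgf (R : realType) (r theta p : R) :
  0 <= r -> 0 < theta < 1 -> 1 <= p ->
  (\sum_(0 <= n <oo)
     ((1 - theta) `^ r * rising_coef r n * theta ^+ n *
      p `^ (- (r + n%:R)))%:E =
   (((1 - theta) / (p - theta)) `^ r)%:E)%E.
Proof.
move=> r0 /andP[t0 t1] p1; have p0 : 0 < p by lra.
under eq_eseriesr => n _.
  have -> : (1 - theta) `^ r * rising_coef r n * theta ^+ n *
      p `^ (- (r + n%:R)) =
      (1 - theta) `^ r * p `^ (- r) * (rising_coef r n * (theta / p) ^+ n).
    rewrite opprD powRD ?(gt_eqF p0) ?implybT// powR_invn ?ltW// expr_div_n.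
    by ring.
  over.
rewrite nneseries_rising// ?divr_ge0 ?ltW//=; last first.
  by rewrite ltr_pdivrMr//; lra.
congr EFin; rewrite powRM ?invr_ge0; [|lra..].
rewrite -mulrA -powRM ?ltW//; last by rewrite subr_gt0 ltr_pdivrMr//; lra.
have -> : p * (1 - theta / p) = p - theta.
  by rewrite mulrBr mulr1 mulrC divfK ?gt_eqF.
by rewrite -[in RHS]powR_inv1 -?powRrM ?mulN1r//; lra.
Qed.

(** * Laplace transform of the subordinator *)

Theorem proposition3p4 (R : realType) (d : measure_display)
    (T : measurableType d) (P : probability T R)
    (q : nat) (lambda theta : R) (a : 'I_q -> R)
    (hlambda : 0 < lambda) (htheta0 : 0 < theta) (htheta1 : theta < 1)
    (ha : forall i, 0 < a i)
    (Z : 'I_q -> R -> {RV P >-> R}) (B : R -> {RV P >-> R})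
    (hG : mgamma_components lambda Z B theta a)
    (s : 'I_q -> R) (hs : forall i, 0 < s i) (t : R) (ht : 0 <= t) :
  ('E_P[fun w => expR (- \sum_(i < q) s i * mgamma_subordinator lambda Z B t i w)] =
   (((1 - theta) / (\prod_(i < q) (1 + s i * (a i)^-1) - theta))
      `^ (lambda * t))%:E)%E.
Proof.
case: hG => lawZ [_ lawB] indepZB.
set r := lambda * t; set p := \prod_(i < q) _.
have r0 : 0 <= r by rewrite mulr_ge0// ltW.
have theta01 : 0 < theta < 1 by rewrite htheta0.
have sa1 i : 1 <= 1 + s i * (a i)^-1.
  by rewrite lerDl mulr_ge0 ?invr_ge0 ?ltW.
have p1 : 1 <= p.
  by rewrite /p; elim/big_ind: _ => // x y x1 y1; rewrite mulr_ege1.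
pose u n := t + lambda^-1 * n%:R.
have u0 n : 0 <= u n by rewrite addr_ge0// mulr_ge0// invr_ge0 ltW.
have lu n : lambda * u n = r + n%:R.
  by rewrite mulrDr mulrA divff ?mul1r ?gt_eqF.
pose M n := B r @^-1` [set n%:R].
have mM n : measurable (M n) by rewrite -[M n]setTI; exact: measurable_funP.
have PM n : P (M n) = ((1 - theta) `^ r * rising_coef r n * theta ^+ n)%:E.
  by rewrite lawB// rbinomial_rising.
have tM : trivIset setT M.
  apply/trivIsetP => i j _ _ ij; apply/seteqP; split=> // w [].
  rewrite /M/= => -> /eqP.
  by rewrite eqr_nat (negbTE ij).
(* [B r] is almost surely a natural number: its prescribed masses sum to [1], by the series at
   [p = 1]. *)
have PN : P (~` \bigcup_n M n) = 0%E.
  rewrite probability_setC; last exact: bigcup_measurable.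
  rewrite measure_bigcup//= (eq_eseriesl (Q := xpredT)); last first.
    by move=> n; rewrite in_setT.
  rewrite (eq_eseriesr (g := fun n => ((1 - theta) `^ r * rising_coef r n *
     theta ^+ n * 1 `^ (- (r + n%:R)))%:E)); last first.
    by move=> n _; rewrite PM powR1 mulr1.
  by rewrite negative_binomial_pgf// divff ?powR1 ?subee// gt_eqF// subr_gt0.
rewrite unlock.
set f := fun w => _.
(* On [M n] the random time is the constant [u n], so there the integrand is a measurable function
   of the processes at fixed times. *)
pose g n w : R := expR (- \sum_(i < q) s i * Z i (u n) w).
have fg n w : M n w -> f w = (g n w)%:E.
  by rewrite /M /= /f /g /mgamma_subordinator -/r => ->.
have mg n : measurable_fun setT (fun w => (g n w)%:E).
  apply/measurable_EFinP; apply: measurableT_comp => //.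
  apply: measurableT_comp => //; apply: measurable_sum => i.
  exact: measurable_funM.
have mf : measurable_fun (\bigcup_n M n) f.
  apply/measurable_fun_bigcup => // n.
  apply: (eq_measurable_fun (fun w => (g n w)%:E)).
    by move=> w; rewrite inE => /fg ->.
  exact: measurable_funTS.
have f0 w : (0 <= f w)%E by rewrite lee_fin expR_ge0.
have mUM : measurable (\bigcup_n M n) by exact: bigcup_measurable.
rewrite (ge0_eq_integral_off_null (g := f \_ (\bigcup_n M n)) _ PN)//;
  last 4 first.
- exact: measurableC.
- exact/(measurable_restrictT _ _).1.
- by move=> w; exact: erestrict_ge0.
- by move=> w /contrapT Mw; rewrite patchE mem_set.
rewrite -integral_mkcond ge0_integral_bigcup//.
rewrite -(negative_binomial_pgf _ theta01 p1)//.
apply: eq_eseriesr => n _.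
transitivity (\int[P]_w ((g n w)%:E * (\1_(M n) w)%:E))%E.
  rewrite integral_mkcond; apply: eq_integral => w _.
  rewrite patchE indicE; case: ifPn => [|_]; last by rewrite mule0.
  by rewrite inE mule1 => /fg.
(* The indicator of [M n] becomes one more independent factor, a function of [B r] indexed by
   [None], so the integral over [M n] is the expectation of a product. *)
pose X (o : option 'I_q) : {RV P >-> R} :=
  if o is Some i then Z i (u n) else B r.
pose phi (o : option 'I_q) (x : R) : R :=
  if o is Some i then expR (- (s i * x)) else \1_[set n%:R] x.
have intZ i : (\int[P]_w (phi (Some i) (X (Some i) w))%:E =
   ((1 + s i * (a i)^-1) `^ (- (r + n%:R)))%:E)%E.
  by rewrite (gamma_process_laplace hlambda (ha i) (hs i) (u0 n) (lawZ i)) lu.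
have intB : (\int[P]_w (phi None (X None w))%:E = P (M n))%E.
  by rewrite -[M n]setIT -integral_indic.
transitivity (\int[P]_w (\prod_o phi o (X o w))%:E)%E.
  apply: eq_integral => w _; rewrite -EFinM; congr EFin.
  rewrite big_option mulrC; congr (_ * _).
  by rewrite /g -sumrN expR_sum.
rewrite indep_expectation_prod.
- rewrite big_option intB PM.
  rewrite (eq_bigr _ (fun i _ => intZ i)).
  rewrite prodEFin prod_powR -?EFinM// => i.
  by rewrite (le_trans _ (sa1 i)).
(* Events of one variable at a fixed nonnegative time belong to the sigma-algebra of its process. *)
- move=> J A AJ; apply: indepZB => -[i|] /AJ Ai; apply: sub_sigma_algebra.
    by exists (u n); [exact: u0|].
  by exists r.
- move=> [i|] /=; last exact: measurable_indic.
  exact: measurable_expRNM.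
- by move=> [i|] x //=; exact: expR_ge0.
- move=> [i|]; first by rewrite intZ.
  by rewrite intB PM.
Qed.
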